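(* Let $f$ be a polynomial with real coefficients of degree $n\ge 5$, with $n$ odd. Then there exists a point $P$ of the plane, not on the graph of $f$, such that $I_f(P)=3$.
   Context: For a differentiable function $f$ on $\mathbb{R}$ and a point $P$ not on the graph of $f$, the illumination index $I_f(P)$ is the number of distinct lines that are tangent to the graph of $f$ (i.e. lines $y=f(c)+f'(c)(x-c)$ for some $c\in\mathbb{R}$) and pass through $P$; a line tangent at several points is counted once. The value $\infty$ is allowed in general. *)

(* Defs.v *)
From HB Require Import structures.
From mathcomp Require Import all_boot all_order all_algebra.
From mathcomp Require Import all_classical all_reals all_analysis.
Import Order.TTheory GRing.Theory Num.Theory.
Import numFieldNormedType.Exports.
Set Implicit Arguments.
Unset Strict Implicit.
Unset Printing Implicit Defensive.
Local Open Scope classical_set_scope.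
Local Open Scope ring_scope.

Definition graph (R : realType) (f : R -> R) : set (R * R) :=
  [set Q : R * R | Q.2 = f Q.1].

Definition tangent_line (R : realType) (f : R -> R) (c : R) : set (R * R) :=
  [set Q : R * R | Q.2 = f c + (f^`())%classic c * (Q.1 - c)].

(* A set of lines, each line being a subset of the plane: a line tangent at
   several abscissas c is a single element. *)
Definition tangents_through (R : realType) (f : R -> R) (P : R * R) :
    set (set (R * R)) :=
  [set L | (exists c : R, L = tangent_line f c) /\ L P].

(* [counting] gives the cardinality of a finite set and +oo otherwise. The
   value is only meaningful for f differentiable and P not on its graph. *)
Definition illumination_index (R : realType) (f : R -> R) (P : R * R) :
    \bar R :=
  counting (tangents_through f P).

(* Main.v *)
Require Import Defs.
From HB Require Import structures.
From mathcomp Require Import all_boot all_order all_algebra.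
From mathcomp Require Import all_classical all_reals all_analysis.
From mathcomp Require Import finmap polyrcf ring lra.
Import Order.TTheory GRing.Theory Num.Theory.
Import numFieldNormedType.Exports.
Local Open Scope classical_set_scope.
Local Open Scope ring_scope.

Set Implicit Arguments.
Unset Strict Implicit.
Unset Printing Implicit Defensive.

(** Up to a reflection of the plane in the horizontal axis, the leading
coefficient of [p] is positive. Since [n] is odd, [p] is then concave far to
the left, say on ]-oo, r], and convex far to the right, say on [s, +oo[; what
happens on [r, s] is arbitrary ([concave_then_convex]).

Let [g c] be the height at abscissa [a] of the tangent line at [c], that is
g c = p c + p'(c) (a - c). The tangent line at [c] passes through (a, b) exactly
when g c = b, and everything rests on the identity g' c = p''(c) (a - c).
For fixed [c] the number [g c] is affine in [a], with bounded coefficients as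
[c] runs over [r, s], while [p a] grows faster than any affine function. So for
a large [a] there is a height [b] with g < b on [r, s] and b < p a = g a
([apex_above_tangents]). The middle part [r, s] then contributes no tangent line
through (a, b), however wildly [p] behaves there. On the three remaining
intervals ]-oo, r], [s, a] and [a, +oo[, [g] is strictly monotone and goes
respectively from +oo to below [b], from below [b] to above it, and from above
[b] to -oo. Hence exactly three points of tangency c1 < r, s < c2 < a < c3
([three_tangencies_odd]).

Three points of tangency give three lines provided that the slopes differ. The
slopes at [c2] and [c3] differ because p' increases on [s, +oo[. If the line
tangent at [c1] were tangent at d = c2 or c3 as well, its slope would be the
mean slope of [p] over [c1, d], hence be attained by p' strictly inside
([bitangent_slope_attained]). But [s] can be chosen with p' < p' s on [r, s[, so
that p' lies strictly below the common slope on all of ]c1, d[. *)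

(** * Polynomials near infinity and monotonicity *)

Lemma size_lead_coef_gt0 (R : realFieldType) (p : {poly R}) (k : nat) :
  (size p <= k.+1)%N -> 0 < p`_k -> size p = k.+1 /\ lead_coef p = p`_k.
Proof.
move=> sp pk; have szp : size p = k.+1.
  apply/eqP; rewrite eqn_leq sp /= ltnNge; apply/negP => /leq_sizeP/(_ k).
  by move=> /(_ (leqnn _)) pk0; rewrite pk0 ltxx in pk.
by rewrite lead_coefE szp.
Qed.

Lemma poly_gt_near_pinfty (R : realFieldType) (p : {poly R}) (k : nat) (B : R) :
  (0 < k)%N -> (size p <= k.+1)%N -> 0 < p`_k ->
  exists M, forall x, M <= x -> B < p.[x].
Proof.
move=> k0 sp pk; have [szp lcp] := size_lead_coef_gt0 sp pk.
have [||M HM] := @poly_lim_infty _ p (B + 1); rewrite ?lcp ?szp //.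
by exists M => x /HM; apply: lt_le_trans; rewrite ltrDl ltr01.
Qed.

(** Apply the behaviour at +oo to - p(- x), which for odd [k] has the same
leading coefficient as [p]. *)
Lemma odd_poly_lt_near_ninfty (R : realFieldType) (p : {poly R}) (k : nat)
    (B : R) :
  odd k -> (size p <= k.+1)%N -> 0 < p`_k ->
  exists M, forall x, x <= M -> p.[x] < B.
Proof.
move=> kodd sp pk; have [szp lcp] := size_lead_coef_gt0 sp pk.
pose q := - (p \Po - 'X).
have szq : size q = k.+1.
  by rewrite size_polyN size_comp_poly2 ?szp // size_polyN size_polyX.
have qk : 0 < q`_k.
  suff <- : lead_coef q = q`_k.
    rewrite lead_coefN lead_coef_comp ?size_polyN ?size_polyX // lcp szp.
    by rewrite lead_coefN lead_coefX -signr_odd /= kodd expr1 mulrN1 opprK.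
  by rewrite lead_coefE szq.
have szq' : (size q <= k.+1)%N by rewrite szq.
have [M HM] := poly_gt_near_pinfty (- B) (odd_gt0 kodd) szq' qk.
exists (- M) => x xM; have := HM (- x).
by rewrite /q hornerN horner_comp !hornerE opprK ltrN2; apply; rewrite lerNr.
Qed.

Lemma poly_deriv_gt0_lt (R : rcfType) (p : {poly R}) (x y : R) :
  x < y -> (forall z, x < z < y -> 0 < p^`().[z]) -> p.[x] < p.[y].
Proof.
move=> xy dp; have [z zxy E] := poly_mvt p xy.
rewrite -subr_gt0 E mulr_gt0 ?subr_gt0 //; apply: dp.
by rewrite in_itv in zxy.
Qed.

Lemma poly_deriv_lt0_gt (R : rcfType) (p : {poly R}) (x y : R) :
  x < y -> (forall z, x < z < y -> p^`().[z] < 0) -> p.[y] < p.[x].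
Proof.
move=> xy dp; rewrite -ltrN2 -!hornerN; apply: poly_deriv_gt0_lt => // z.
by move=> /dp; rewrite derivN hornerN oppr_gt0.
Qed.

Lemma poly_attains_between (R : rcfType) (p : {poly R}) (x y b : R) :
  x < y -> (p.[x] - b) * (p.[y] - b) < 0 -> exists2 c, x < c < y & p.[c] = b.
Proof.
move=> xy.
have E z : p.[z] - b = (p - b%:P).[z] by rewrite !hornerE.
rewrite !E => sgn; have [c] := poly_ivtoo (ltW xy) sgn.
rewrite in_itv /= => cxy.
by rewrite rootE !hornerE subr_eq0 => /eqP pc; exists c.
Qed.

(** * Heights of tangent lines above a fixed abscissa *)

Definition tangent_height (R : nzRingType) (p : {poly R}) (a : R) : {poly R} :=
  p + p^`() * (a%:P - 'X).

Lemma horner_tangent_height (R : comNzRingType) (p : {poly R}) (a c : R) :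
  (tangent_height p a).[c] = p.[c] + p^`().[c] * (a - c).
Proof. by rewrite /tangent_height !hornerE. Qed.

(** The terms in p' cancel, so the variations of the height are governed by the
convexity of [p] and by the side of [a] only. *)
Lemma deriv_tangent_height (R : comNzRingType) (p : {poly R}) (a c : R) :
  (tangent_height p a)^`().[c] = p^`(2).[c] * (a - c).
Proof.
rewrite /tangent_height derivD derivM derivB derivC derivX derivSn derivn1.
by rewrite !(hornerD, hornerM, hornerN, hornerC, hornerX); ring.
Qed.

(** In degree k = deg p this gives (1 - k) times the leading coefficient: for
[k > 1] the height has the degree of [p] and the opposite behaviour at
infinity. *)
Lemma coef_tangent_height (R : comNzRingType) (p : {poly R}) (a : R) (k : nat) :
  (tangent_height p a)`_k = a * p`_k.+1 *+ k.+1 + p`_k - p`_k *+ k.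
Proof.
rewrite /tangent_height mulrBr mulrC coefD coefB coefCM coefMX !coef_deriv.
by case: k => [|k] /=; ring.
Qed.

(** * The position of the point *)

Section Shape.

Variables (R : realType) (p : {poly R}) (k : nat).
Hypotheses (k_odd : odd k) (k_ge3 : (3 <= k)%N).
Hypotheses (size_p : (size p <= k.+1)%N) (pk_gt0 : 0 < p`_k).

(** The bound on p' over [r, s[ is obtained by pushing [s] to the right: p' is
bounded on the compact part, tends to +oo, and increases on the convex part. It
is what later excludes lines tangent on both sides. *)
Lemma concave_then_convex : exists r s : R,
  [/\ r < s, forall x, x <= r -> p^`(2).[x] < 0,
      forall x, s <= x -> 0 < p^`(2).[x] &
      forall x, r <= x < s -> p^`().[x] < p^`().[s]].
Proof.
have [m kE] : exists m, k = m.+3 by exists (k - 3)%N; rewrite -addn3 subnK.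
move: k_odd size_p pk_gt0; rewrite kE => m_odd sp pm.
have sd1 : (size p^`() <= m.+3)%N.
  apply/leq_sizeP => j mj.
  by rewrite coef_deriv nth_default ?mul0rn // (leq_trans sp).
have sd2 : (size p^`(2) <= m.+2)%N.
  apply/leq_sizeP => j mj.
  by rewrite coef_derivn nth_default ?mul0rn // (leq_trans sp).
have c1 : 0 < p^`()`_m.+2 by rewrite coef_deriv pmulrn_lgt0.
have c2 : 0 < p^`(2)`_m.+1.
  by rewrite coef_derivn !addSn add0n pmulrn_lgt0 // ffact_gt0.
have [|r r_concave] := odd_poly_lt_near_ninfty 0 _ sd2 c2.
  by move: m_odd; rewrite /= negbK.
have [s0 s0_convex] := poly_gt_near_pinfty 0 (ltn0Sn m) sd2 c2.
have [K K_bound] := poly_itv_bound p^`() r s0.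
have [s1 s1_slope] := poly_gt_near_pinfty K (ltn0Sn m.+1) sd1 c1.
pose s := Num.max s0 (Num.max s1 (r + 1)).
have [s0s s1s rs] : [/\ s0 <= s, s1 <= s & r < s].
  rewrite /s !le_max !lt_max !lexx !orbT ltrDl ltr01 !orbT; split => //.
exists r, s; split => // [x sx|x /andP[rx xs]].
  by apply: s0_convex; apply: le_trans sx.
have [xs0|s0x] := leP x s0.
  apply: le_lt_trans (s1_slope _ s1s); apply: le_trans (ler_norm _) _.
  by apply: K_bound; rewrite rx.
apply: poly_deriv_gt0_lt => // z /andP[xz _].
by apply: s0_convex; rewrite ltW // (lt_trans s0x).
Qed.

(** Over [r, s] the heights are at most F + K (a - r), where [F] and [K] bound
[p] and p' there; as [k >= 2] the polynomial p - K X still tends to +oo, so [p]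
overtakes this affine function of [a]. *)
Lemma apex_above_tangents (r s : R) : exists a b : R,
  [/\ s < a, b < p.[a] &
      forall x, r <= x <= s -> (tangent_height p a).[x] < b].
Proof.
have [F F_bound] := poly_itv_bound p r s.
have [K0 K0_bound] := poly_itv_bound p^`() r s.
pose K := `|K0|.
pose q := p - K *: 'X.
have sq : (size q <= k.+1)%N.
  rewrite (leq_trans (size_polyD _ _)) // geq_max size_p size_polyN.
  rewrite (leq_trans (size_scale_leq _ _)) // size_polyX.
  by rewrite ltnS (leq_trans _ k_ge3).
have qk : 0 < q`_k.
  rewrite /q coefB coefZ coefX gtn_eqF ?(leq_trans _ k_ge3) //.
  by rewrite mulr0 subr0.
have [M HM] := poly_gt_near_pinfty (F + 1 - K * r) (odd_gt0 k_odd) sq qk.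
pose a := Num.max M (s + 1).
have sa : s < a by rewrite lt_max ltrDl ltr01 orbT.
exists a, (F + 1 + K * (a - r)); split => //.
  have := HM a; rewrite le_max lexx => /(_ isT).
  by rewrite /q !hornerE => ?; lra.
move=> x /[dup] xrs /andP[rx xs]; rewrite horner_tangent_height.
have px := le_trans (ler_norm _) (F_bound _ xrs).
have dpx : p^`().[x] <= K.
  apply: le_trans (ler_norm _) (le_trans (K0_bound _ xrs) (ler_norm _)).
have K_ge0 : 0 <= K by apply: normr_ge0.
have : p^`().[x] * (a - x) <= K * (a - r) by nra.
lra.
Qed.

End Shape.

(** * Exactly three tangency points, with distinct slopes *)

(** Equal slopes and equal heights at [a] mean that the two tangent lines
coincide; their slope is then the mean slope of [p] over [c, d], and the mean
value theorem applies. *)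
Lemma bitangent_slope_attained (R : rcfType) (p : {poly R}) (a c d : R) :
  c < d -> (tangent_height p a).[c] = (tangent_height p a).[d] ->
  p^`().[c] = p^`().[d] -> exists2 z, c < z < d & p^`().[z] = p^`().[d].
Proof.
move=> cd; rewrite !horner_tangent_height => E S.
have [z zcd] := poly_mvt p cd; rewrite in_itv /= in zcd => Ez.
exists z => //; have dc : d - c != 0 by rewrite subr_eq0 gt_eqF.
apply: (mulIf dc); rewrite -Ez; rewrite S in E; lra.
Qed.

(** Two non-vertical lines through a common point are equal exactly when their
slopes are: distinctness of the tangent lines is therefore expressed by the
values of p'. In this form the property is visibly stable under p -> - p. *)
Definition three_tangencies (R : realType) (p : {poly R}) :=
  exists a b c1 c2 c3 : R,
  [/\ b != p.[a],
      forall c, (tangent_height p a).[c] = b <-> [\/ c = c1, c = c2 | c = c3] &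
      uniq [:: p^`().[c1]; p^`().[c2]; p^`().[c3]]].

Lemma three_tangencies_opp (R : realType) (p : {poly R}) :
  three_tangencies p -> three_tangencies (- p).
Proof.
move=> [a [b [c1 [c2 [c3 [ba H U]]]]]]; exists a, (- b), c1, c2, c3; split.
- by rewrite hornerN eqr_opp.
- move=> c; rewrite -H !horner_tangent_height derivN !hornerN.
  by split => E; lra.
- by move: U; rewrite derivN !hornerN /= !inE !eqr_opp.
Qed.

(** The height is strictly monotone on each side of [r, s] and of [a], and the
interval [r, s] is skipped because the height stays below [b] there. *)
Lemma three_tangencies_odd (R : realType) (p : {poly R}) (k : nat) :
  odd k -> (3 <= k)%N -> (size p <= k.+1)%N -> 0 < p`_k -> three_tangencies p.
Proof.
move=> k_odd k3 size_p pk.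
have [r [s [rs concave convex slope]]] :=
  concave_then_convex k_odd k3 size_p pk.
have [a [b [sa bpa low]]] := apex_above_tangents k_odd k3 size_p pk r s.
pose g := tangent_height p a.
have gE c : g.[c] = p.[c] + p^`().[c] * (a - c) by apply: horner_tangent_height.
have gr : g.[r] < b by apply: low; rewrite lexx ltW.
have gs : g.[s] < b by apply: low; rewrite lexx ltW.
have ga : b < g.[a] by rewrite gE subrr mulr0 addr0.
have g_left x y : x < y -> y <= r -> g.[y] < g.[x].
  move=> xy yr; apply: poly_deriv_lt0_gt => // z /andP[xz zy].
  rewrite deriv_tangent_height nmulr_rlt0 ?subr_gt0; first by lra.
  by apply: concave; lra.
have g_mid x y : x < y -> s <= x -> y <= a -> g.[x] < g.[y].
  move=> xy sx ya; apply: poly_deriv_gt0_lt => // z /andP[xz zy].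
  rewrite deriv_tangent_height mulr_gt0 ?subr_gt0 //; last by lra.
  by apply: convex; lra.
have g_right x y : x < y -> a <= x -> g.[y] < g.[x].
  move=> xy ax; apply: poly_deriv_lt0_gt => // z /andP[xz zy].
  rewrite deriv_tangent_height pmulr_rlt0 ?subr_lt0; first by lra.
  by apply: convex; lra.
have sNg : (size (- g) <= k.+1)%N.
  rewrite size_polyN; apply/leq_sizeP => j kj; rewrite coef_tangent_height.
  have pj i : (k < i)%N -> p`_i = 0.
    by move=> ki; rewrite nth_default // (leq_trans size_p).
  by rewrite !pj ?mulr0 ?mul0rn ?addr0 ?subr0 // (leq_trans kj).
have Ngk : 0 < (- g)`_k.
  rewrite coefN coef_tangent_height [p`_k.+1]nth_default //.
  rewrite mulr0 mul0rn add0r opprB subr_gt0 -[X in X < _]mulr1n ltr_pMn2l //.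
  exact: leq_trans k3.
have [L HL] := odd_poly_lt_near_ninfty (- b) k_odd sNg Ngk.
have [N HN] := poly_gt_near_pinfty (- b) (odd_gt0 k_odd) sNg Ngk.
pose l := Num.min L (r - 1); pose u := Num.max N (a + 1).
have lr : l < r by rewrite gt_min; apply/orP; right; lra.
have au : a < u by rewrite lt_max; apply/orP; right; lra.
have gl : b < g.[l] by rewrite -ltrN2 -hornerN HL // ge_min lexx.
have gu : g.[u] < b by rewrite -ltrN2 -hornerN HN // le_max lexx.
have [|c1 /andP[lc1 c1r] gc1] := @poly_attains_between _ g l r b lr.
  by nra.
have [|c2 /andP[sc2 c2a] gc2] := @poly_attains_between _ g s a b sa.
  by nra.
have [|c3 /andP[ac3 c3u] gc3] := @poly_attains_between _ g a u b au.
  by nra.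
have slope_right x y : x < y -> s <= x -> p^`().[x] < p^`().[y].
  move=> xy sx; apply: poly_deriv_gt0_lt => // z /andP[xz zy].
  by apply: convex; lra.
have slope_left x y : x < y -> y <= r -> p^`().[y] < p^`().[x].
  move=> xy yr; apply: poly_deriv_lt0_gt => // z /andP[xz zy].
  by apply: concave; lra.
(* Here p' z is the common slope p' c1 = p' d with c1 < z < d; each position of
   z with respect to r and s contradicts the variations of p'. *)
have no_bitangent d : s < d -> g.[d] = b -> p^`().[c1] != p^`().[d].
  move=> sd gd; apply/eqP => E.
  have [||z /andP[c1z zd] zE] := @bitangent_slope_attained _ p a c1 d _ _ E.
  - lra.
  - by rewrite [LHS]gc1 [RHS]gd.
  have sd' := slope_right _ _ sd (lexx s).
  have [zr|rz] := leP z r.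
    by have := slope_left _ _ c1z zr; rewrite E zE ltxx.
  have [sz|zs] := leP s z.
    by have := slope_right _ _ zd sz; rewrite zE ltxx.
  by have := slope z; rewrite (ltW rz) zs zE => /(_ isT); lra.
exists a, b, c1, c2, c3; split.
- by rewrite lt_eqF.
- move=> c; split; last by case=> ->.
  rewrite -/g => gc.
  have [cr|rc] := leP c r.
    apply: Or31; case: (ltgtP c c1) => // h.
    - by have := g_left _ _ h (ltW c1r); rewrite gc gc1 ltxx.
    - by have := g_left _ _ h cr; rewrite gc gc1 ltxx.
  have [cs|sc] := leP c s.
    by have := low c; rewrite (ltW rc) cs -/g gc ltxx => /(_ isT).
  have [ca|ac] := leP c a.
    apply: Or32; case: (ltgtP c c2) => // h.
    - by have := g_mid _ _ h (ltW sc) (ltW c2a); rewrite gc gc2 ltxx.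
    - by have := g_mid _ _ h (ltW sc2) ca; rewrite gc gc2 ltxx.
  apply: Or33; case: (ltgtP c c3) => // h.
  - by have := g_right _ _ h (ltW ac); rewrite gc gc3 ltxx.
  - by have := g_right _ _ h (ltW ac3); rewrite gc gc3 ltxx.
- rewrite /= !inE !negb_or !no_bitangent //; try lra.
  by rewrite lt_eqF // slope_right ?(ltW sc2) //; lra.
Qed.

(** * Counting the lines *)

Lemma counting_set3 (T : choiceType) (R : realType) (x y z : T) :
  x <> y -> x <> z -> y <> z -> counting [set x; y; z] = 3%:E :> \bar R.
Proof.
move=> /eqP xy /eqP xz /eqP yz.
rewrite /counting asboolT; last exact: finite_set3.
rewrite !fset_setU ?fset_set1 //.
rewrite [fsetU _ [fset z]%fset]fsetUC.
rewrite -[size _]/#|` _| cardfsU1 cardfs2 !inE negb_or.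
by rewrite xy (eq_sym z) xz (eq_sym z) yz.
Qed.

(** Compare the lines, as sets, at the abscissas 0 and 1. *)
Lemma tangent_line_slope_inj (R : realType) (f : R -> R) (c d : R) :
  tangent_line f c = tangent_line f d ->
  (f^`())%classic c = (f^`())%classic d.
Proof.
move=> E.
have on x : f c + (f^`())%classic c * (x - c) =
    f d + (f^`())%classic d * (x - d).
  have : tangent_line f c (x, f c + (f^`())%classic c * (x - c)) by [].
  by rewrite E.
by have := on 0; have := on 1; lra.
Qed.

Lemma illumination_index3 (R : realType) (p : {poly R}) :
  three_tangencies p -> exists P : R * R,
    ~ graph (fun x : R => p.[x]) P /\
    illumination_index (fun x : R => p.[x]) P = 3%:E.
Proof.
move=> [a [b [c1 [c2 [c3 [ba H U]]]]]]; exists (a, b); split.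
  by move=> E; case/eqP: ba.
have dE : ((fun x : R => p.[x])^`())%classic = horner p^`() by rewrite derivE.
rewrite /illumination_index.
pose T := tangent_line (fun x : R => p.[x]).
have onT c : T c (a, b) <-> (tangent_height p a).[c] = b.
  by rewrite horner_tangent_height /T /tangent_line /= dE; split.
have Tneq c d : p^`().[c] != p^`().[d] -> T c <> T d.
  by move=> /eqP cd /tangent_line_slope_inj; rewrite dE.
have -> : tangents_through (fun x : R => p.[x]) (a, b) = [set T c1; T c2; T c3].
  apply/seteqP; split => [_ [[c ->]] | _ [[]|] -> ].
  - by move=> /onT/H[] ->; [left; left|left; right|right].
  - by split; [exists c1|apply/onT/H; apply: Or31].
  - by split; [exists c2|apply/onT/H; apply: Or32].
  - by split; [exists c3|apply/onT/H; apply: Or33].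
move: U; rewrite /= !inE negb_or => /and3P[/andP[U12 U13] U23 _].
by apply: counting_set3; exact: Tneq.
Qed.

Theorem theorem3p2 (R : realType) (n : nat) (p : {poly R})
    (size_p : size p = n.+1) (n_ge5 : (5 <= n)%N) (n_odd : odd n) :
  exists P : R * R,
    ~ graph (fun x : R => p.[x]) P /\
    illumination_index (fun x : R => p.[x]) P = 3%:E.
Proof.
have n_ge3 : (3 <= n)%N by apply: leq_trans n_ge5.
apply: illumination_index3.
have: p`_n != 0.
  have -> : p`_n = lead_coef p by rewrite lead_coefE size_p.
  by rewrite lead_coef_eq0 -size_poly_eq0 size_p.
rewrite neq_lt => /orP[pn|pn]; last first.
  by apply: (three_tangencies_odd n_odd) pn; rewrite // size_p.
rewrite -[p]opprK; apply: three_tangencies_opp.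
apply: (three_tangencies_odd n_odd); rewrite ?size_polyN ?size_p //.
by rewrite coefN oppr_gt0.
Qed.
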